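(* (a) $NN(IP_n)\ge 2^{n/2}$. (b) $NN(x_1\oplus\cdots\oplus x_n)\ge n+1$.
   Context: For a Boolean function $f:\{0,1\}^m\to\{0,1\}$, a nearest neighbor representation is a pair of disjoint sets $(P,N)$ of points of $\mathbb R^m$ such that for every $a\in\{0,1\}^m$: if $f(a)=1$, there is $b\in P$ with $d(a,b)<d(a,c)$ for all $c\in N$; if $f(a)=0$, there is $b\in N$ with $d(a,b)<d(a,c)$ for all $c\in P$ ($d$ = Euclidean distance). $NN(f)$ is the minimum of $|P\cup N|$ over all such representations. The mod 2 inner product function of $2n$ variables is $IP_n(x_1,\dots,x_n,y_1,\dots,y_n)=(x_1\wedge y_1)\oplus\cdots\oplus(x_n\wedge y_n)$. *)

(* Defs.v *)
From HB Require Import structures.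
From mathcomp Require Import all_boot all_order all_algebra.
From mathcomp Require Import reals.
From mathcomp Require Import finmap.
Set Implicit Arguments. Unset Strict Implicit. Unset Printing Implicit Defensive.
Import Order.TTheory GRing.Theory Num.Theory.
Local Open Scope ring_scope.
Local Open Scope fset_scope.

Notation bvec m := 'rV[bool]_m.

Definition bpt (R : realType) (m : nat) (a : bvec m) : 'rV[R]_m :=
  \row_(i < m) (nat_of_bool (a 0 i))%:R.

Definition edist (R : realType) (m : nat) (x y : 'rV[R]_m) : R :=
  Num.sqrt (\sum_(i < m) (x 0 i - y 0 i) ^+ 2).

Definition NN_rep (R : realType) (m : nat) (f : bvec m -> bool)
    (P N : {fset 'rV[R]_m}) : Prop :=
  [disjoint P & N] /\
  forall a : bvec m,
    (f a -> exists2 b, b \in P &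
        forall c, c \in N -> edist (bpt R a) b < edist (bpt R a) c) /\
    (~~ f a -> exists2 b, b \in N &
        forall c, c \in P -> edist (bpt R a) b < edist (bpt R a) c).

Definition NN_ge (R : realType) (m : nat) (f : bvec m -> bool) (k : R) : Prop :=
  forall P N : {fset 'rV[R]_m}, NN_rep f P N -> k <= (#|` P `|` N|)%:R.

Definition IP (n : nat) (a : bvec (n + n)) : bool :=
  \big[addb/false]_(i < n) (a 0 (lshift n i) && a 0 (rshift n i)).

Definition XOR (n : nat) (a : bvec n) : bool :=
  \big[addb/false]_(i < n) a 0 i.

(* Main.v *)
(** Replace the minimum over anchors by a soft minimum: for large [t], the sign of
    [\sum_b +/- exp (- t d(a, b)^2)], with sign [-1] on [P] and [+1] on [N], is
    [(-1) ^ f a], with an arbitrarily small relative error.  Every term is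
    positive and is a product of functions of the single coordinates of [a].

    For the parity of [n] variables, a positive combination of the restrictions
    [a_n = 0] and [a_n = 1] (the latter negated) cancels one term and still has the
    sign of the parity of the other [n - 1] variables; so there are more than [n]
    terms.

    For [IP_n], this is a sign representation, of positive rank-one terms
    [a x b * c y b], of a 2^n x 2^n Hadamard matrix, and Forster's argument
    simplifies.  Rescaling each term [b] by some [z b], and then normalizing rows to
    probability vectors [p x] and [q y], one can make all column sums
    [\sum_x p x b] nearly equal.  The correlation of the matrix with
    [\sum_b +/- p x b * q y b] is then nearly at least [4^n / K], [K] being the number of
    anchors, whereas it is at most [2^n * sqrt (2^n)] by orthogonality. *)

Require Import Defs.
From HB Require Import structures.
From mathcomp Require Import all_boot all_order all_algebra.
From mathcomp Require Import reals sequences exp.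
From mathcomp Require Import ring lra.
From mathcomp Require Import finmap.
Set Implicit Arguments. Unset Strict Implicit. Unset Printing Implicit Defensive.
Import Order.TTheory GRing.Theory Num.Theory.
Local Open Scope ring_scope.

(** * Number of product terms in a sign representation of parity *)

(** Induction on [n], eliminating one term per variable. The coefficients [c] are arbitrary reals,
    since elimination loses control of their signs. Strictness rules out the empty sum. *)
Lemma parity_terms (R : realFieldType) (T : Type) (n : nat)
    (W : T -> nat -> bool -> R) (c : T -> R) (s : seq T) :
  (forall b i e, 0 < W b i e) ->
  (forall a : nat -> bool,
     0 < (-1) ^+ (\big[addb/false]_(i < n) a i) *
         \sum_(b <- s) c b * \prod_(i < n) W b i (a i)) ->
  (n < size s)%N.
Proof.
move=> W0; elim: n c s => [|n IH] c [|b0 s] H //.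
- by have := H (fun=> false); rewrite big_nil mulr0 ltxx.
- by have := H (fun=> false); rewrite big_nil mulr0 ltxx.
rewrite /= ltnS.
(* The restrictions to last bit [false] and [true] get the weights [W b0 n true] and
   [- W b0 n false], so the coefficient of [b0] vanishes. The sign change of the parity compensates
   for the minus. *)
apply: (IH (fun b => c b * (W b0 n true * W b n false - W b0 n false * W b n true))) => a.
have {H} Ha (e : bool) : 0 < (-1) ^+ (\big[addb/false]_(i < n) a i) * (-1) ^+ e *
    \sum_(b <- b0 :: s) c b * (\prod_(i < n) W b i (a i) * W b n e).
  have := H (fun i => if i == n then e else a i).
  rewrite big_ord_recr /= eqxx signr_addb.
  have -> : \big[addb/false]_(i < n) (if i == n :> nat then e else a i) =
            \big[addb/false]_(i < n) a i.
    by apply: eq_bigr => i _; rewrite (ltn_eqF (ltn_ord i)).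
  congr (_ < _ * _); apply: eq_bigr => b _; congr (_ * _).
  rewrite big_ord_recr /= eqxx; congr (_ * _).
  by apply: eq_bigr => i _; rewrite (ltn_eqF (ltn_ord i)).
have := addr_gt0 (mulr_gt0 (W0 b0 n true) (Ha false))
                 (mulr_gt0 (W0 b0 n false) (Ha true)).
congr (_ < _); rewrite expr0 expr1 !big_cons.
set S0 := \sum_(b <- s) _; set S1 := \sum_(b <- s) _; set S := \sum_(b <- s) _.
have -> : S = W b0 n true * S0 - W b0 n false * S1.
  rewrite /S /S0 /S1 !mulr_sumr -sumrB; apply: eq_bigr => b _; ring.
ring.
Qed.

(** * Soft minimum *)

Lemma softmin_concentration (R : realType) (A B : finType)
    (wrong : A -> B -> bool) (d : A -> B -> R) (eps : R) :
  0 < eps ->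
  (forall a, exists b0, forall b, wrong a b -> d a b0 < d a b) ->
  exists t : R, forall a,
    \sum_(b | wrong a b) expR (- (t * d a b)) <= eps * \sum_b expR (- (t * d a b)).
Proof.
move=> eps0 /fin_all_exists[b0 Hb0].
pose gap (p : A * B) := d p.1 p.2 - d p.1 (b0 p.1).
(* The default [1] keeps [dl] positive even if no pair is wrong. *)
pose dl := \big[Num.min/1]_(p : A * B | wrong p.1 p.2) gap p.
have dl0 : 0 < dl.
  by apply: lt_bigmin => // p Hp; rewrite subr_gt0 Hb0.
pose K : R := #|B|%:R.
have [B0|Bn0] := posnP #|B|.
  by exists 0 => a; have := fintype0 (b0 a) B0.
have K0 : 0 < K by rewrite ltr0n.
(* From [expR u >= 1 + u >= u] at [u = t * dl = K / eps], each of the at most [K] wrong terms is at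
   most [eps / K] times the term of [b0 a]. *)
exists (K / (eps * dl)) => a; set t := K / _.
have t0 : 0 < t by rewrite divr_gt0 // mulr_gt0.
have Htd : expR (- (t * dl)) <= eps / K.
  rewrite expRN -[eps / K]invf_div lef_pV2 ?posrE ?expR_gt0 ?divr_gt0 //.
  have -> : K / eps = t * dl by rewrite /t; field; rewrite !gt_eqF.
  by apply: le_trans (expR_ge1Dx _); rewrite lerDr.
have Hb b : wrong a b ->
    expR (- (t * d a b)) <= eps / K * expR (- (t * d a (b0 a))).
  move=> wb.
  have -> : - (t * d a b) = - (t * gap (a, b)) + - (t * d a (b0 a)).
    by rewrite /gap /=; ring.
  rewrite expRD ler_pM2r ?expR_gt0 //; apply: le_trans Htd.
  rewrite ler_expR lerN2 ler_pM2l //.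
  exact: (bigmin_le_cond _ (j := (a, b))).
apply: (le_trans (ler_sum _ Hb)).
apply: (@le_trans _ _ (\sum_(b : B) eps / K * expR (- (t * d a (b0 a))))).
  rewrite [leRHS](bigID (wrong a)) /= lerDl sumr_ge0 // => b _.
  by rewrite mulr_ge0 ?expR_ge0 // divr_ge0 // ltW.
rewrite sumr_const -mulr_natl -/K.
have -> : K * (eps / K * expR (- (t * d a (b0 a)))) = eps * expR (- (t * d a (b0 a))).
  by field; rewrite gt_eqF.
rewrite ler_pM2l // [leRHS](bigD1 (b0 a)) //= lerDl sumr_ge0 // => b _.
exact: expR_ge0.
Qed.

(** * Scaling to nearly equal column sums, and Forster's argument *)

(** The potential [Phi] is bounded below, because [Z z x] dominates every [a x b * z b], whereas a
    light column always allows a decrease by a fixed amount. So light columns cannot persist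
    forever. *)
Lemma column_scaling (R : realType) (X B : finType) (a : X -> B -> R) (eps : R) :
  (0 < #|X|)%N -> 0 < eps -> (forall x b, 0 < a x b) ->
  exists2 z : B -> R, (forall b, 0 < z b) &
    forall b, (1 - eps) * #|X|%:R <=
      #|B|%:R * \sum_x (a x b * z b / \sum_c a x c * z c).
Proof.
move=> X0 eps0 a0.
pose Z (z : B -> R) x := \sum_c a x c * z c.
pose Phi z := #|B|%:R * \sum_x ln (Z z x) - #|X|%:R * \sum_b ln (z b).
have le1Z (z : B -> R) : (forall b, 0 < z b) -> forall x b, a x b * z b <= Z z x.
  move=> z0 x b; rewrite /Z (bigD1 b) //= lerDl sumr_ge0 // => c _.
  by rewrite ltW ?mulr_gt0.
have PhiE z : Phi z = \sum_b \sum_x (ln (Z z x) - ln (z b)).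
  under eq_bigr do rewrite sumrB.
  rewrite sumrB /Phi sumr_const mulr_natl; congr (_ - _).
  by rewrite mulr_sumr; apply: eq_bigr => b _; rewrite sumr_const mulr_natl.
pose L := \sum_b \sum_x ln (a x b).
have Phi_ge (z : B -> R) : (forall b, 0 < z b) -> L <= Phi z.
  move=> z0; rewrite PhiE; apply: ler_sum => b _; apply: ler_sum => x _.
  rewrite lerBrDr -lnM ?posrE // ler_ln ?posrE ?mulr_gt0 ?le1Z //.
  by apply: lt_le_trans (le1Z _ z0 _ b); rewrite mulr_gt0.
(* The first term is the gain from [ln (z b)]; the second bounds the loss from the growth of the row
   sums when column [b] is light. The difference is positive since [ln (1 + eps) >= eps / (1 + eps)
   > eps * (1 - eps)]. *)
pose dl := #|X|%:R * (ln (1 + eps) - eps * (1 - eps)).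
have dl0 : 0 < dl.
  rewrite mulr_gt0 ?ltr0n // subr_gt0.
  have e1 : 0 < 1 + eps by lra.
  have : ln ((1 + eps)^-1) <= (1 + eps)^-1 - 1.
    have := @le_ln1Dx _ ((1 + eps)^-1 - 1).
    by rewrite subrKC; apply; rewrite ltrBrDr addNr invr_gt0.
  rewrite lnV ?posrE // lerNl; apply: lt_le_trans.
  rewrite -(ltr_pM2r e1) opprB mulrBl mulVf ?gt_eqF //.
  have := exprn_gt0 3 eps0; lra.
have [//|H] := boolp.pselect (exists2 z : B -> R, (forall b, 0 < z b) &
    forall b, (1 - eps) * #|X|%:R <= #|B|%:R * \sum_x (a x b * z b / Z z x)).
(* multiplying by [1 + eps] the scale of a light column decreases [Phi] by [dl] *)
have step (z : B -> R) : (forall b, 0 < z b) ->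
    exists2 z' : B -> R, (forall b, 0 < z' b) & Phi z' <= Phi z - dl.
  move=> z0.
  have [b Hb] : exists b, #|B|%:R * \sum_x (a x b * z b / Z z x) < (1 - eps) * #|X|%:R.
    apply: boolp.contrapT => nb; apply: H; exists z => // b.
    by rewrite leNgt; apply/negP => lb; apply: nb; exists b.
  pose z' c := if c == b then (1 + eps) * z c else z c.
  have e1 : 0 < 1 + eps by lra.
  exists z' => [c|]; first by rewrite /z'; case: ifP => _; rewrite ?mulr_gt0.
  have Zp x : 0 < Z z x by apply: lt_le_trans (le1Z _ z0 x b); rewrite mulr_gt0.
  have p0 x : 0 <= a x b * z b / Z z x by rewrite ltW // divr_gt0 ?mulr_gt0.
  have ZE x : Z z' x = Z z x * (1 + eps * (a x b * z b / Z z x)).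
    have -> : Z z x * (1 + eps * (a x b * z b / Z z x)) = Z z x + eps * (a x b * z b).
      by field; rewrite gt_eqF.
    rewrite /Z (bigD1 b) //= [in RHS](bigD1 b) //= /z' eqxx.
    under eq_bigr => c /negPf cb do rewrite cb.
    ring.
  have lnZ x : ln (Z z' x) <= ln (Z z x) + eps * (a x b * z b / Z z x).
    have q0 : 0 <= eps * (a x b * z b / Z z x) by rewrite mulr_ge0 // ltW.
    rewrite ZE lnM ?posrE //; last by lra.
    by rewrite lerD2l le_ln1Dx //; lra.
  have lnz : \sum_c ln (z' c) = \sum_c ln (z c) + ln (1 + eps).
    rewrite (bigD1 b) //= [in RHS](bigD1 b) //= /z' eqxx lnM ?posrE //.
    under eq_bigr => c /negPf cb do rewrite cb.
    ring.
  have HZ : \sum_x ln (Z z' x) <=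
      \sum_x ln (Z z x) + eps * \sum_x (a x b * z b / Z z x).
    by rewrite mulr_sumr -big_split /=; apply: ler_sum.
  have HK := ler_wpM2l (ler0n R #|B|) HZ.
  have Hb' := ler_wpM2l (ltW eps0) (ltW Hb).
  rewrite /Phi /dl lnz.
  move: HK Hb'; move: (\sum_x (_ / _)) (\sum_x ln _) (\sum_x ln _) => S1 S2 S3.
  move: (ln (1 + eps)) => l; lra.
have iter m : exists2 z : B -> R, (forall b, 0 < z b) &
    Phi z <= Phi (fun=> 1) - m%:R * dl.
  elim: m => [|m [z z0 Hz]]; first by exists (fun=> 1) => [_|]; rewrite ?ltr01 // mul0r subr0.
  have [z' z'0 Hz'] := step z z0.
  by exists z' => //; rewrite -natr1; lra.
(* This many steps bring [Phi] below its lower bound [L]. *)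
have [z z0 Hz] := iter (Num.truncn ((Phi (fun=> 1) - L) / dl)).+1.
have := Phi_ge z z0.
have := truncnS_gt ((Phi (fun=> 1) - L) / dl).
rewrite ltr_pdivrMr //; lra.
Qed.

(** [M] has operator norm at most [s]. Entries of probability vectors dominate their squares, so [p]
    and [q] each have total squared norm at most [s ^ 2]; Cauchy-Schwarz, in AM-GM form, gives
    [s * s ^ 2]. *)
Lemma sum_signed_products_le (R : realFieldType) (X Y B : finType)
    (M : X -> Y -> R) (s : R) (sg : B -> R) (p : X -> B -> R) (q : Y -> B -> R) :
  0 < s -> #|X|%:R = s ^+ 2 -> #|Y|%:R = s ^+ 2 ->
  (forall v : X -> R,
     \sum_y (\sum_x M x y * v x) ^+ 2 <= s ^+ 2 * \sum_x v x ^+ 2) ->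
  (forall b, sg b ^+ 2 = 1) ->
  (forall x b, 0 <= p x b) -> (forall x, \sum_b p x b = 1) ->
  (forall y b, 0 <= q y b) -> (forall y, \sum_b q y b = 1) ->
  \sum_x \sum_y M x y * \sum_b sg b * (p x b * q y b) <= s ^+ 3.
Proof.
move=> s0 cX cY HM sg1 p0 p1 q0 q1.
have sqle (I : finType) (g : I -> B -> R) : (forall i b, 0 <= g i b) ->
    (forall i, \sum_b g i b = 1) -> \sum_i \sum_b g i b ^+ 2 <= #|I|%:R.
  move=> g0 g1; rewrite -[#|I|%:R](@sumr_const _ _ I 1); apply: ler_sum => i _.
  rewrite -(g1 i); apply: ler_sum => b _.
  have gle1 : g i b <= 1.
    by rewrite -(g1 i) [leRHS](bigD1 b) //= lerDl sumr_ge0.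
  by rewrite expr2 ler_piMr.
pose r b y := \sum_x M x y * p x b.
have -> : \sum_x \sum_y M x y * \sum_b sg b * (p x b * q y b) =
          \sum_b \sum_y sg b * (r b y * q y b).
  rewrite exchange_big /= [RHS]exchange_big; apply: eq_bigr => y _.
  under eq_bigr do rewrite mulr_sumr.
  rewrite exchange_big; apply: eq_bigr => b _.
  by rewrite /r mulr_suml mulr_sumr; apply: eq_bigr => x _; ring.
(* AM-GM: [2 r q <= s q^2 + r^2 / s] *)
have AG b y : sg b * (r b y * q y b) <= (s * q y b ^+ 2 + s^-1 * r b y ^+ 2) / 2.
  have sK : s^-1 * s = 1 by rewrite mulVf // gt_eqF.
  have : 0 <= s^-1 * (sg b * r b y - s * q y b) ^+ 2.
    by rewrite mulr_ge0 ?sqr_ge0 // invr_ge0 ltW.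
  have -> : s^-1 * (sg b * r b y - s * q y b) ^+ 2 =
     s^-1 * (sg b ^+ 2 * r b y ^+ 2) - 2 * (s^-1 * s) * (sg b * (r b y * q y b))
     + s^-1 * s * (s * q y b ^+ 2) by ring.
  rewrite sg1 sK; lra.
apply: (@le_trans _ _ (\sum_b \sum_y (s * q y b ^+ 2 + s^-1 * r b y ^+ 2) / 2)).
  by apply: ler_sum => b _; apply: ler_sum => y _.
have -> : \sum_b \sum_y (s * q y b ^+ 2 + s^-1 * r b y ^+ 2) / 2 =
   (s * (\sum_y \sum_b q y b ^+ 2) + s^-1 * \sum_b \sum_y r b y ^+ 2) / 2.
  under eq_bigr do rewrite -mulr_suml big_split /= -!mulr_sumr.
  by rewrite -mulr_suml big_split /= -!mulr_sumr; congr ((s * _ + _) / 2); rewrite exchange_big.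
have Hr : \sum_b \sum_y r b y ^+ 2 <= s ^+ 2 * s ^+ 2.
  apply: (@le_trans _ _ (s ^+ 2 * \sum_b \sum_x p x b ^+ 2)).
    by rewrite mulr_sumr; apply: ler_sum => b _; apply: HM.
  rewrite ler_wpM2l ?sqr_ge0 // exchange_big /= -cX; exact: sqle.
have Hq : \sum_y \sum_b q y b ^+ 2 <= s ^+ 2 by rewrite -cY; apply: sqle.
(* The weight [s] in AM-GM balances the two halves: each is at most [s ^ 3]. *)
have {Hr} : s^-1 * (\sum_b \sum_y r b y ^+ 2) <= s ^+ 3.
  rewrite mulrC ler_pdivrMr //; apply: le_trans Hr _.
  by rewrite le_eqVlt; apply/orP; left; apply/eqP; ring.
have := ler_wpM2l (ltW s0) Hq.
rewrite -exprS; lra.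
Qed.

(** The upper bound [s ^ 3] on the correlation meets the lower bound [(1 - eps) ^ 2 * s ^ 4 / K]:
    one factor [1 - eps] comes from the sign approximation, the other from the column scaling. *)
Lemma positive_sign_rank (R : realType) (X Y B : finType)
    (M : X -> Y -> R) (s : R) (sg : B -> R) :
  0 < s -> #|X|%:R = s ^+ 2 -> #|Y|%:R = s ^+ 2 ->
  (forall v : X -> R,
     \sum_y (\sum_x M x y * v x) ^+ 2 <= s ^+ 2 * \sum_x v x ^+ 2) ->
  (forall b, sg b ^+ 2 = 1) ->
  (0 < #|B|)%N ->
  (forall eps : R, 0 < eps -> eps < 1 ->
     exists a : X -> B -> R, exists c : Y -> B -> R,
       [/\ forall x b, 0 < a x b, forall y b, 0 < c y b &
           forall x y, (1 - eps) * \sum_b a x b * c y b <=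
                       M x y * \sum_b sg b * (a x b * c y b)]) ->
  s <= #|B|%:R.
Proof.
move=> s0 cX cY HM sg1 B0 H.
have X0 : (0 < #|X|)%N by rewrite -(ltr0n R) cX exprn_gt0.
rewrite leNgt; apply/negP => Ks; set K : R := #|B|%:R in Ks *.
have K0 : 0 < K by rewrite ltr0n.
(* Chosen so that [(1 - eps) ^ 2 * s = K + eps ^ 2 * s], which exceeds [K]. *)
pose eps := (s - K) / (2 * s).
have epsE : eps * (2 * s) = s - K by rewrite /eps divfK // gt_eqF // mulr_gt0.
have eps0 : 0 < eps by rewrite divr_gt0 ?mulr_gt0 ?subr_gt0.
have eps1 : eps < 1 by rewrite ltr_pdivrMr ?mulr_gt0 //; lra.
have [a [c [a0 c0 Hac]]] := H eps eps0 eps1.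
have [z z0 Hz] := column_scaling X0 eps0 a0.
(* Scaling [a] by [z] and [c] by its inverse preserves the products. Normalization then multiplies
   all terms at [(x, y)] by one positive factor, so the hypothesis on [a] and [c] passes to [p] and
   [q]. *)
pose Z x := \sum_b a x b * z b; pose V y := \sum_b c y b / z b.
have [b0 _] := card_gt0P B0.
have sum_gt0 (g : B -> R) : (forall b, 0 < g b) -> 0 < \sum_b g b.
  move=> g0; rewrite (bigD1 b0) //= ltr_wpDr // sumr_ge0 // => b _; exact: (ltW (g0 b)).
have Z0 x : 0 < Z x by apply: sum_gt0 => b; rewrite mulr_gt0.
have V0 y : 0 < V y by apply: sum_gt0 => b; rewrite divr_gt0.
pose p x b := a x b * z b / Z x; pose q y b := c y b / z b / V y.
have p0 x b : 0 <= p x b by rewrite ltW // divr_gt0 ?mulr_gt0.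
have q0 y b : 0 <= q y b by rewrite ltW // !divr_gt0.
have p1 x : \sum_b p x b = 1 by rewrite -mulr_suml mulfV // gt_eqF ?Z0.
have q1 y : \sum_b q y b = 1 by rewrite -mulr_suml mulfV // gt_eqF ?V0.
have pqE x y b : p x b * q y b = (Z x * V y)^-1 * (a x b * c y b).
  by rewrite /p /q; field; rewrite !gt_eqF.
have Hpq x y : (1 - eps) * \sum_b p x b * q y b <=
               M x y * \sum_b sg b * (p x b * q y b).
  have -> : \sum_b p x b * q y b = (Z x * V y)^-1 * \sum_b a x b * c y b.
    by rewrite mulr_sumr; apply: eq_bigr => b _.
  have -> : \sum_b sg b * (p x b * q y b) =
            (Z x * V y)^-1 * \sum_b sg b * (a x b * c y b).
    by rewrite mulr_sumr; apply: eq_bigr => b _; rewrite pqE mulrCA.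
  by rewrite mulrCA [leRHS]mulrCA ler_pM2l // invr_gt0 mulr_gt0.
have Hup := sum_signed_products_le s0 cX cY HM sg1 p0 p1 q0 q1.
have {Hpq} Hlow : (1 - eps) * \sum_y \sum_b (\sum_x p x b) * q y b <= s ^+ 3.
  apply: le_trans Hup.
  have -> : (1 - eps) * \sum_y \sum_b (\sum_x p x b) * q y b =
            \sum_x \sum_y (1 - eps) * \sum_b p x b * q y b.
    rewrite [RHS]exchange_big mulr_sumr; apply: eq_bigr => y _.
    rewrite -mulr_sumr exchange_big; congr (_ * _).
    by apply: eq_bigr => b _; rewrite mulr_suml.
  by apply: ler_sum => x _; apply: ler_sum => y _; apply: Hpq.
(* Each [q y] is a probability vector, so the sum over [b] is an average of column sums of [p], all
   at least [(1 - eps) * s ^ 2 / K]. *)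
have Hcol : (1 - eps) * s ^+ 2 * s ^+ 2 <= K * \sum_y \sum_b (\sum_x p x b) * q y b.
  rewrite -{2}cY -[#|Y|%:R](@sumr_const _ _ Y 1) !mulr_sumr; apply: ler_sum => y _.
  have -> : (1 - eps) * s ^+ 2 * 1 = \sum_b (1 - eps) * s ^+ 2 * q y b.
    by rewrite -mulr_sumr q1.
  rewrite mulr_sumr; apply: ler_sum => b _.
  by rewrite mulrA ler_wpM2r // -cX; apply: Hz.
have e1 : 0 < 1 - eps by lra.
have : (1 - eps) * ((1 - eps) * s ^+ 2 * s ^+ 2) <= K * s ^+ 3.
  apply: le_trans (ler_wpM2l (ltW e1) Hcol) _.
  by rewrite mulrCA ler_pM2l.
have -> : (1 - eps) * ((1 - eps) * s ^+ 2 * s ^+ 2) = (1 - eps) ^+ 2 * s * s ^+ 3 by ring.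
rewrite ler_pM2r ?exprn_gt0 //.
have : 0 < eps ^+ 2 * s by rewrite mulr_gt0 ?exprn_gt0.
have -> : (1 - eps) ^+ 2 * s = s - eps * (2 * s) + eps ^+ 2 * s by ring.
lra.
Qed.

(** * Orthogonality of the inner product matrix *)

(** The inner product of two rows factors over the coordinates, and a coordinate where [x] and [x']
    differ contributes [1 + (-1) = 0]. *)
Lemma sum_signIP_sqr (R : realFieldType) (n : nat)
    (v : {ffun 'I_n -> bool} -> R) :
  \sum_(y : {ffun 'I_n -> bool})
     (\sum_(x : {ffun 'I_n -> bool})
        (-1) ^+ (\big[addb/false]_(i < n) (x i && y i)) * v x) ^+ 2 =
  2 ^+ n * \sum_x v x ^+ 2.
Proof.
pose M (x y : {ffun 'I_n -> bool}) : R := (-1) ^+ (\big[addb/false]_(i < n) (x i && y i)).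
have ME x y : M x y = \prod_i (-1) ^+ (x i && y i).
  by rewrite /M; apply: (big_morph (fun b : bool => (-1) ^+ b) (@signr_addb R)).
have ortho x x' : \sum_y M x y * M x' y = (x == x')%:R * 2 ^+ n.
  under eq_bigr do rewrite !ME -big_split /=.
  rewrite -(bigA_distr_bigA (fun i b => (-1) ^+ (x i && b) * (-1) ^+ (x' i && b))) /=.
  have E i : \sum_b ((-1) ^+ (x i && b) * (-1) ^+ (x' i && b) : R) = (x i == x' i)%:R * 2.
    by rewrite big_bool /=; case: (x i); case: (x' i); rewrite /= ?expr0 ?expr1; ring.
  under eq_bigr do rewrite E.
  rewrite big_split /= prodr_const card_ord; congr (_ * _).
  case: (eqVneq x x') => [->|nxx']; first by rewrite big1 // => i _; rewrite eqxx.
  have [i nxi] : exists i, x i != x' i.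
    apply/existsP; apply: contraR nxx'; rewrite negb_exists => /forallP H.
    by apply/eqP/ffunP => i; apply/eqP; rewrite -[_ == _]negbK H.
  by rewrite (bigD1 i) //= (negPf nxi) mul0r.
transitivity (\sum_x \sum_x' v x * v x' * \sum_y M x y * M x' y).
  under [RHS]eq_bigr do under eq_bigr do rewrite mulr_sumr.
  under [RHS]eq_bigr do rewrite exchange_big.
  rewrite [RHS]exchange_big; apply: eq_bigr => y _.
  rewrite expr2 mulr_suml; apply: eq_bigr => x _.
  by rewrite mulr_sumr; apply: eq_bigr => x' _; rewrite -!/(M _ _); ring.
rewrite mulr_sumr; apply: eq_bigr => x _.
rewrite (bigD1 x) //= [X in _ + X]big1 ?addr0 => [|x' /negPf nx].
  by rewrite ortho eqxx mul1r mulrC expr2.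
by rewrite ortho eq_sym nx mul0r mulr0.
Qed.

(** * From nearest neighbor representations to signed sums of exponentials *)

(** Without the square root, distances compare in the same way and the exponential factors over the
    coordinates. *)
Definition sqdist (R : realType) (m : nat) (x y : 'rV[R]_m) : R :=
  \sum_(i < m) (x 0 i - y 0 i) ^+ 2.

Lemma lt_edist_sqdist (R : realType) (m : nat) (x y z : 'rV[R]_m) :
  edist x y < edist x z -> sqdist x y < sqdist x z.
Proof.
move=> lt_d; have : 0 < edist x z by apply: le_lt_trans lt_d; apply: sqrtr_ge0.
by rewrite sqrtr_gt0 => z0; rewrite -ltr_sqrt.
Qed.

(** Merges the two cases of the representation into the form used by the soft minimum: an anchor is
    wrong for [a] when its membership in [P] disagrees with [f a]. *)
Lemma NN_rep_nearest (R : realType) (m : nat) (f : bvec m -> bool)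
    (P N : {fset 'rV[R]_m}) (a : bvec m) :
  NN_rep f P N ->
  exists b0 : (P `|` N)%fset, forall b : (P `|` N)%fset, f a (+) (val b \in P) ->
    sqdist (bpt R a) (val b0) < sqdist (bpt R a) (val b).
Proof.
move=> [_ /(_ a)].
case: (f a) => -[rP rN].
  have [//|b0 b0P Hb] := rP _.
  have b0U : b0 \in (P `|` N)%fset by rewrite inE b0P.
  exists [` b0U]%fset => b /= bP.
  apply: lt_edist_sqdist; apply: Hb.
  by have := valP b; rewrite inE (negPf bP).
have [//|b0 b0N Hb] := rN _.
have b0U : b0 \in (P `|` N)%fset by rewrite inE b0N orbT.
by exists [` b0U]%fset => b /= bP; apply: lt_edist_sqdist; apply: Hb.
Qed.

Lemma NN_rep_soft (R : realType) (m : nat) (f : bvec m -> bool)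
    (P N : {fset 'rV[R]_m}) (eps : R) :
  NN_rep f P N -> 0 < eps ->
  exists t : R, forall a : bvec m,
    (1 - eps) * \sum_(b : (P `|` N)%fset) expR (- (t * sqdist (bpt R a) (val b))) <=
    (-1) ^+ (f a) * \sum_(b : (P `|` N)%fset)
       (-1) ^+ (val b \in P) * expR (- (t * sqdist (bpt R a) (val b))).
Proof.
move=> rep eps0.
pose wrong (a : bvec m) (b : (P `|` N)%fset) := f a (+) (val b \in P).
(* The signed sum is the total minus twice the wrong part, hence the halving. *)
have e2 : 0 < eps / 2 by rewrite divr_gt0.
have [t Ht] := softmin_concentration (wrong := wrong) e2 (fun a => NN_rep_nearest a rep).
exists t => a; have := Ht a.
set E := fun b : (P `|` N)%fset => expR (- (t * sqdist (bpt R a) (val b))).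
have -> : (-1) ^+ f a * \sum_(b : (P `|` N)%fset) (-1) ^+ (val b \in P) * E b =
          \sum_b E b - 2 * \sum_(b | wrong a b) E b.
  rewrite [X in _ - 2 * X]big_mkcond !mulr_sumr -sumrB; apply: eq_bigr => b _.
  rewrite mulrA -signr_addb -/(wrong a b).
  by case: (wrong a b); rewrite ?expr0 ?expr1; ring.
lra.
Qed.

(** * The two lower bounds *)

Lemma NN_ge_XOR (R : realType) (n : nat) : NN_ge (@XOR n) (n.+1%:R : R).
Proof.
(* Any constant strictly between [0] and [1] would do: only the sign of the signed sum matters
   here. *)
move=> P N rep; have e1 : 0 < 1 / 2 :> R by lra.
have [t Ht] := NN_rep_soft rep e1.
rewrite ler_nat cardfE.
have [b0 _] := NN_rep_nearest 0 rep.
(* Coordinates are indexed by natural numbers to fit [parity_terms]; the default [0] is never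
   reached in the product over [i < n]. *)
pose W (b : (P `|` N)%fset) (i : nat) (e : bool) : R :=
  expR (- (t * (e%:R - (if insub i is Some j then val b 0 j else 0)) ^+ 2)).
rewrite cardE.
apply: (@parity_terms R _ n W (fun b => (-1) ^+ (val b \in P))) => [b i e|a].
  exact: expR_gt0.
have := Ht (\row_i a i).
set E := fun b : (P `|` N)%fset => expR (- (t * sqdist (bpt R (\row_i a i)) (val b))).
rewrite -!/(E _) => Ha.
have -> : \big[addb/false]_(i < n) a i = @XOR n (\row_i a i).
  by apply: eq_bigr => i _; rewrite mxE.
have WE b : \prod_(i < n) W b i (a i) = E b.
  rewrite /E /sqdist mulr_sumr -sumrN expR_sum; apply: eq_bigr => i _.
  by rewrite /W valK !mxE.
under eq_bigr do rewrite WE.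
rewrite big_enum /=; apply: lt_le_trans Ha.
rewrite mulr_gt0 //; first by lra.
rewrite (bigD1 b0) //= ltr_wpDr ?expR_gt0 // sumr_ge0 // => b _; exact: expR_ge0.
Qed.

Lemma NN_ge_IP (R : realType) (n : nat) : NN_ge (@IP n) (Num.sqrt (2 : R) ^+ n).
Proof.
move=> P N rep; rewrite cardfE.
pose ev (x y : {ffun 'I_n -> bool}) : bvec (n + n) :=
  row_mx (\row_i x i) (\row_i y i).
have evE x y : IP (ev x y) = \big[addb/false]_(i < n) (x i && y i).
  by apply: eq_bigr => i _; rewrite row_mxEl row_mxEr !mxE.
have s2 : (Num.sqrt 2 ^+ n) ^+ 2 = 2 ^+ n :> R.
  by rewrite -exprM mulnC exprM sqr_sqrtr // ler0n.
have cX : #|{ffun 'I_n -> bool}|%:R = (Num.sqrt 2 ^+ n) ^+ 2 :> R.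
  by rewrite s2 card_ffun card_bool card_ord natrX.
(* Here [s ^ 2 = 2 ^ n] is both the size of the index sets and the squared operator norm. *)
apply: (@positive_sign_rank R _ _ _
  (fun x y : {ffun 'I_n -> bool} => (-1) ^+ (\big[addb/false]_(i < n) (x i && y i)))
  _ (fun b : (P `|` N)%fset => (-1) ^+ (val b \in P)) _ cX cX).
- by rewrite exprn_gt0 // sqrtr_gt0.
- by move=> v; rewrite sum_signIP_sqr s2.
- by move=> b; rewrite sqrr_sign.
- by have [b _] := NN_rep_nearest 0 rep; apply/card_gt0P; exists b.
move=> eps eps0 _; have [t Ht] := NN_rep_soft rep eps0.
(* [h] selects one half of the coordinates of [b]. The squared distance splits over the two halves,
   so its exponential is a function of [x] times a function of [y]. *)
pose D (h : 'I_n -> 'I_(n + n)) (x : {ffun 'I_n -> bool}) (b : (P `|` N)%fset) :=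
  expR (- (t * \sum_(i < n) ((x i)%:R - val b 0 (h i)) ^+ 2)).
exists (D (@lshift n n)), (D (@rshift n n)).
split=> [x b|y b|x y]; rewrite ?expR_gt0 //.
have := Ht (ev x y).
have DE (b : (P `|` N)%fset) : expR (- (t * sqdist (bpt R (ev x y)) (val b))) =
  D (@lshift n n) x b * D (@rshift n n) y b.
  rewrite -expRD -opprD -mulrDr /sqdist big_split_ord /=.
  under eq_bigr do rewrite mxE row_mxEl mxE.
  by under [X in _ + X]eq_bigr do rewrite mxE row_mxEr mxE.
rewrite evE; under eq_bigr do rewrite DE.
by under [X in _ <= _ * X]eq_bigr do rewrite DE.
Qed.

Theorem theorem8 (R : realType) (n : nat) :
  NN_ge (@IP n) (Num.sqrt (2 : R) ^+ n) /\ NN_ge (@XOR n) (n.+1%:R : R).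
Proof. by split; [apply: NN_ge_IP | apply: NN_ge_XOR]. Qed.
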